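(* Let $\lambda>0$, $h>0$, let $W$ be a continuous increasing waiting-time function as described in the context, let $p>0$, and let $\mathcal{P}$ be an ambiguity set (a set of probability distributions of a nonnegative random variable $X$). Assume that: (i) the function $f(x):=\inf_{\mathbb{P}\in\mathcal{P}}\mathbb{P}(X>p+hW(x))$ is continuous; (ii) for every $x$, the infimum $\inf_{\mathbb{P}\in\mathcal{P}}\mathbb{P}(X>p+hW(x))$ is attained by some distribution $\mathbb{P}_x\in\mathcal{P}$. Then $\gamma^*:=\inf_{\mathbb{P}\in\mathcal{P}}\gamma(p,\mathbb{P})$ is the unique solution to the equation $$\gamma^*=\lambda\cdot\inf_{\mathbb{P}\in\mathcal{P}}\mathbb{P}\left(X>p+hW(\gamma^* )\right).$$
   Context: $W:[0,\bar\theta)\to[0,\infty)$, with $0<\bar\theta\le\infty$, is a continuous and (strictly) increasing function; the standard example is $W(\gamma)=\frac{\gamma}{\theta(\theta-\gamma)}$ on $[0,\theta)$. The variable $x$ ranges over $[0,\bar\theta)$, and solutions are sought in $[0,\bar\theta)$. For a distribution $\mathbb{P}$ of $X$, the effective arrival rate $\gamma(p,\mathbb{P})$ is the solution $\gamma\in[0,\bar\theta)$ of $\gamma=\lambda\,\mathbb{P}(X>p+hW(\gamma))$ (there is at most one, since the right-hand side is nonincreasing in $\gamma$), and $\gamma(p,\mathbb{P}):=\infty$ if no solution exists. Standing assumption: there is at least one $\mathbb{P}\in\mathcal{P}$ with $\gamma(p,\mathbb{P})<\infty$. *)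

(* Defs.v *)
From mathcomp Require Import all_boot all_order all_algebra.
From mathcomp Require Import all_classical all_reals all_analysis.

Set Implicit Arguments.
Unset Strict Implicit.
Unset Printing Implicit Defensive.

Import Order.TTheory GRing.Theory Num.Theory.
Import numFieldTopology.Exports numFieldNormedType.Exports.

Local Open Scope classical_set_scope.
Local Open Scope ring_scope.

(* A distribution of X is given by its law on the real line. *)
Notation law R := (probability (measurableTypeR R) R).

Definition rate_dom (R : realType) (thetabar : \bar R) : set R :=
  [set x | 0 <= x /\ (x%:E < thetabar)%E].

Record waiting_time (R : realType) (thetabar : \bar R) (W : R -> R) : Prop := {
  waiting_ge0 : forall x, rate_dom thetabar x -> 0 <= W x ;
  waiting_cont : {within rate_dom thetabar, continuous W} ;
  waiting_incr : forall x y, rate_dom thetabar x -> rate_dom thetabar y ->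
    x < y -> W x < W y }.

Section EffectiveArrivalRate.
Context {R : realType}.
Variables (thetabar : \bar R) (lambda h : R) (W : R -> R) (p : R).

Definition join_prob (P : law R) (x : R) : \bar R :=
  P [set t : R | p + h * W x < t].

Definition inf_join_prob (PP : set (law R)) (x : R) : \bar R :=
  ereal_inf [set join_prob P x | P in PP].

Definition rate_solution (q : R -> \bar R) (g : R) : Prop :=
  rate_dom thetabar g /\ g%:E = (lambda%:E * q g)%E.

(* The solution is unique when it exists, so the choice made by xget does not
   matter; xget returns +oo when there is none. *)
Definition effective_rate (P : law R) : \bar R :=
  xget +oo%E [set g%:E | g in rate_solution (join_prob P)].

Definition inf_effective_rate (PP : set (law R)) : \bar R :=
  ereal_inf [set effective_rate P | P in PP].

End EffectiveArrivalRate.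

(* Main.v *)
(* The map x |-> inf_P P(X > p + h W(x)) is nonincreasing, so its rescaling by
   lambda has at most one fixed point.  A solution g0 for some P satisfies
   lambda * f(g0) <= g0, and the intermediate value theorem on [0, g0] yields a
   fixed point g.  The distribution attaining the infimum at g has effective rate
   g, while an effective rate gP < g would give
   gP >= lambda * f(gP) >= lambda * f(g) = g. *)

Require Import Defs.
From mathcomp Require Import all_boot all_order all_algebra.
From mathcomp Require Import all_classical all_reals all_analysis.

Import Order.TTheory GRing.Theory Num.Theory.
Import numFieldTopology.Exports numFieldNormedType.Exports.

Local Open Scope classical_set_scope.
Local Open Scope ring_scope.

Section RateSolution.
Set Implicit Arguments.
Unset Strict Implicit.
Context {R : realType}.
Variables (thetabar : \bar R) (lambda h p : R) (W : R -> R).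
Hypothesis lambda_gt0 : 0 < lambda.

(** If [y < x], then [x = lambda * q x <= lambda * q y <= lambda * r y = y], a contradiction. With
    [q = r] this gives uniqueness of solutions; with [q] the infimum and [r] the function of one law
    it bounds that law's rate from below. *)
Lemma rate_solution_le (q r : R -> \bar R) (x y : R) :
  {in rate_dom thetabar &, forall a b, a < b -> (q b <= q a)%E} ->
  (forall a, rate_dom thetabar a -> (q a <= r a)%E) ->
  rate_solution thetabar lambda q x -> rate_solution thetabar lambda r y ->
  x <= y.
Proof.
move=> q_anti le_qr [dx ex] [dy ey]; rewrite leNgt; apply/negP => ltyx.
have : (x%:E <= y%:E)%E.
  rewrite ex ey lee_pmul2l ?lte_fin//.
  by rewrite (le_trans _ (le_qr _ dy))// q_anti ?inE.
by rewrite lee_fin leNgt ltyx.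
Qed.

Lemma effective_rateP (P : law R) :
  effective_rate thetabar lambda h W p P = +oo%E \/
  exists2 g, rate_solution thetabar lambda (join_prob h W p P) g &
    effective_rate thetabar lambda h W p P = g%:E.
Proof.
rewrite /effective_rate; case: xgetP => [_ -> [g sol <-]|_]; last by left.
by right; exists g.
Qed.

Hypotheses (h_gt0 : 0 < h) (W_waiting : waiting_time thetabar W).

Lemma join_prob_anti (P : law R) :
  {in rate_dom thetabar &, forall a b, a < b ->
    (join_prob h W p P b <= join_prob h W p P a)%E}.
Proof.
move=> a b /[!inE] da db ltab; apply: le_measure; rewrite ?inE.
- by rewrite -set_itvoy; exact: measurable_itv.
- by rewrite -set_itvoy; exact: measurable_itv.
move=> t /=; apply: le_lt_trans; rewrite lerD2l ler_pM2l//.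
exact/ltW/(waiting_incr W_waiting).
Qed.

Lemma effective_rateE (P : law R) (g : R) :
  rate_solution thetabar lambda (join_prob h W p P) g ->
  effective_rate thetabar lambda h W p P = g%:E.
Proof.
move=> sol; rewrite /effective_rate; apply: xget_unique; first by exists g.
move=> _ [y soly <-]; congr _%:E.
by apply/eqP; rewrite eq_le; apply/andP; split;
  apply: rate_solution_le (@join_prob_anti P) _ _ _.
Qed.

Variable PP : set (law R).

Lemma inf_join_prob_le (P : law R) (x : R) :
  PP P -> (inf_join_prob h W p PP x <= join_prob h W p P x)%E.
Proof. by move=> PPP; apply: ereal_inf_lbound; exists P. Qed.

Lemma inf_join_prob_anti :
  {in rate_dom thetabar &, forall a b, a < b ->
    (inf_join_prob h W p PP b <= inf_join_prob h W p PP a)%E}.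
Proof.
move=> a b da db ltab; apply: le_ereal_inf_tmp => _ [P PPP <-].
exact: le_trans (inf_join_prob_le b PPP) (join_prob_anti P da db ltab).
Qed.

Lemma inf_join_prob_ge0 (x : R) : (0 <= inf_join_prob h W p PP x)%E.
Proof. by apply: le_ereal_inf_tmp => _ [P _ <-]; exact: measure_ge0. Qed.

(** Nonemptiness matters: the infimum over an empty [PP] would be [+oo]. Any member of [PP] bounds
    it by a finite probability. *)
Lemma inf_join_prob_fin_num (x : R) :
  PP !=set0 -> inf_join_prob h W p PP x \is a fin_num.
Proof.
move=> [P PPP]; rewrite ge0_fin_numE ?inf_join_prob_ge0//.
apply: le_lt_trans (inf_join_prob_le x PPP) _.
by rewrite -ge0_fin_numE ?measure_ge0// fin_num_measure// -set_itvoy.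
Qed.

Lemma inf_rate_solution_exists (P : law R) (g0 : R) : PP P ->
  {within rate_dom thetabar, continuous (inf_join_prob h W p PP)} ->
  rate_solution thetabar lambda (join_prob h W p P) g0 ->
  exists g, rate_solution thetabar lambda (inf_join_prob h W p PP) g.
Proof.
move=> PPP f_cont [[g0_ge0 g0_lt] g0E].
set f := inf_join_prob h W p PP in f_cont *.
have f_fin x : f x \is a fin_num by apply: inf_join_prob_fin_num; exists P.
(* The compact interval ending at [g0] stays below [thetabar], whether [thetabar] is finite or
   not. *)
have dom_itv x : x \in `[0, g0] -> rate_dom thetabar x.
  rewrite in_itv/= => /andP[x_ge0 le_xg0]; split=> //.
  by apply: le_lt_trans g0_lt; rewrite lee_fin.
(* Zeros of [F] are the fixed points sought; [fine] makes [F] real-valued, and loses nothing since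
   [f] is finite. *)
pose F x := lambda * fine (f x) - x.
have F_cont : {within `[0, g0], continuous F}.
  have f_cont' : {within `[0, g0], continuous f}.
    by apply: continuous_subspaceW f_cont => x /= /dom_itv.
  apply/subspace_continuousP => x x_itv; apply: cvgB.
    apply: cvgMr; apply: fine_cvg; rewrite fineK//.
    by move/subspace_continuousP: f_cont'; apply.
  exact: cvg_within.
have F0_ge0 : 0 <= F 0.
  by rewrite /F subr0 mulr_ge0 ?fine_ge0 ?inf_join_prob_ge0// ltW.
(* As [g0] solves the equation of [P], this is [lambda * f g0 <= lambda * join_prob h W p P g0 =
   g0]. *)
have Fg0_le0 : F g0 <= 0.
  rewrite subr_le0 -lee_fin EFinM fineK// g0E.
  by rewrite lee_pmul2l ?lte_fin// inf_join_prob_le.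
have [|g /dom_itv dg Fg0] := IVT g0_ge0 F_cont (v := 0).
  by rewrite ge_min le_max F0_ge0 Fg0_le0 orbT.
exists g; split=> //; rewrite -[f g]fineK// -EFinM.
by congr _%:E; apply/esym/eqP; rewrite -subr_eq0; apply/eqP.
Qed.

End RateSolution.

Theorem theorem5p1 (R : realType) (thetabar : \bar R) (lambda h p : R)
    (W : R -> R) (PP : set (law R))
    (thetabar_gt0 : (0 < thetabar)%E)
    (lambda_gt0 : 0 < lambda) (h_gt0 : 0 < h) (p_gt0 : 0 < p)
    (W_waiting : waiting_time thetabar W)
    (PP_nonneg : forall P : law R, PP P -> P [set t : R | 0 <= t] = 1%E)
    (PP_finite : exists2 P : law R, PP P &
      (effective_rate thetabar lambda h W p P < +oo)%E)
    (f_cont : {within rate_dom thetabar, continuous (inf_join_prob h W p PP)})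
    (f_attained : forall x : R, rate_dom thetabar x ->
      exists2 P : law R, PP P & join_prob h W p P x = inf_join_prob h W p PP x) :
  exists g : R,
    [/\ g%:E = inf_effective_rate thetabar lambda h W p PP,
        rate_solution thetabar lambda (inf_join_prob h W p PP) g &
        forall y : R, rate_solution thetabar lambda (inf_join_prob h W p PP) y ->
          y = g].
Proof.
have [P0 PP0 rate0] := PP_finite.
(* A finite rate cannot be the default [+oo], so it comes from a genuine solution [g0]. *)
have [rateE|[g0 sol0 _]] := effective_rateP thetabar lambda h p W P0.
  by rewrite rateE ltxx in rate0.
have [g sol] := inf_rate_solution_exists lambda_gt0 PP0 f_cont sol0.
have f_anti := inf_join_prob_anti p h_gt0 W_waiting PP.
exists g; split=> //; last first.
  move=> y soly; apply/eqP; rewrite eq_le; apply/andP; split.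
  - exact: (rate_solution_le lambda_gt0 f_anti _ soly sol).
  - exact: (rate_solution_le lambda_gt0 f_anti _ sol soly).
apply/eqP; rewrite eq_le; apply/andP; split.
  (* Lower bound: a law without solution has rate [+oo]; otherwise its solution is compared with
     [g]. *)
  apply: le_ereal_inf_tmp => _ [P PPP <-].
  have [->|[gP solP ->]] := effective_rateP thetabar lambda h p W P.
    exact: leey.
  rewrite lee_fin; apply: (rate_solution_le lambda_gt0 f_anti _ sol solP).
  by move=> a _; exact: inf_join_prob_le.
(* Upper bound: at the point [g] the equations of [Pg] and of the infimum coincide, so [g] is the
   rate of [Pg]. *)
have [Pg PPg attained] := f_attained g sol.1.
apply: ereal_inf_lbound; exists Pg => //.
apply: (effective_rateE lambda_gt0 h_gt0 W_waiting).
by case: sol => dg gE; split; rewrite // attained.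
Qed.
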